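(* Let $r\ge1$, $k_1,\dots,k_r\in\mathbb{N}$ (positive integers), $\mathcal{S}=\{(\mathrm{i},k_1),\dots,(\mathrm{i},k_r)\}$ (a multiset; $\mathrm{i}=\sqrt{-1}$) and $m=4(k_1+\dots+k_r)$. Then the nonsingular $2$-step algebra $\mu_{\mathcal{S}}$ of type $(2,m)$ satisfies $$\operatorname{Der}_{gr}(\mu_{\mathcal{S}})/\operatorname{Der}_0(\mu_{\mathcal{S}})\simeq\mathfrak{so}(2).$$
   Context: Let $\mathfrak{n}=\mathfrak{n}_1\oplus\mathfrak{n}_2$ be a real inner product space with $\mathfrak n_1\perp\mathfrak n_2$ and orthonormal bases $\{X_1,\dots,X_m\}$ of $\mathfrak{n}_1$, $\{Z_1,\dots,Z_n\}$ of $\mathfrak{n}_2$ (here $n=2$). A bilinear skew-symmetric map $\mu:\mathfrak{n}_1\times\mathfrak{n}_1\to\mathfrak{n}_2$ is regarded as a $2$-step nilpotent Lie bracket on $\mathfrak{n}$ (with $\mathfrak{n}_2$ central); it is determined by $J_\mu:\mathfrak{n}_2\to\mathfrak{so}(\mathfrak{n}_1)$, $\langle J_\mu(Z)X,Y\rangle=\langle\mu(X,Y),Z\rangle$. Nonsingular means $J_\mu(Z)$ is invertible for all $Z\ne0$. Graded derivations: $$\operatorname{Der}_{gr}(\mu)=\left\{\begin{bmatrix} B & 0 \\ 0 & A \end{bmatrix}: B\in\mathfrak{sl}_m,\ A\in\mathfrak{gl}_n,\ B^tJ_\mu(Z)+J_\mu(Z)B=J_\mu(A^tZ)\ \forall Z\in\mathfrak{n}_2\right\},$$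 i.e. the Lie algebra of derivations of $(\mathfrak{n},\mu)$ preserving $\mathfrak{n}_1$ and $\mathfrak{n}_2$ and having trace zero on $\mathfrak{n}_1$; and $\operatorname{Der}_0(\mu)$ is the ideal of $\operatorname{Der}_{gr}(\mu)$ of those elements with $A=0$. Definition of $\mu_{\mathcal{S}}$: the matrix of $J_{\mu_{\mathcal{S}}}(xZ_1+yZ_2)$ with respect to $\{X_i\}$ is block diagonal with one diagonal block for each element of $\mathcal{S}$. The block attached to $(\mathrm{i},k)$ is the $4k\times4k$ matrix $\begin{bmatrix} 0 & A \\ -A^t & 0 \end{bmatrix}$, where $A$ is the $2k\times2k$ matrix partitioned into $2\times2$ blocks $A_{ij}$, $1\le i,j\le k$, with $$A_{ij}=\begin{bmatrix} -x & y \\ y & x \end{bmatrix}\ (i+j=k+1),\quad A_{ij}=\begin{bmatrix} 0 & x \\ x & 0 \end{bmatrix}\ (i+j=k+2),\quad A_{ij}=0\text{ otherwise}.$$ *)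

(* Defs.v *)
From HB Require Import structures.
From mathcomp Require Import all_boot all_order all_algebra.
From mathcomp Require Import ring.
From mathcomp Require Import sesquilinear boolp reals.

Set Implicit Arguments.
Unset Strict Implicit.
Unset Printing Implicit Defensive.

Import GRing.Theory.

Local Open Scope ring_scope.
Local Open Scope quotient_scope.

HB.mixin Record isLieAlgebra (K : fieldType) L of GRing.Lmodule K L := {
  lie : L -> L -> L;
  lie_linearl : forall y : L, linear (lie^~ y);
  lie_linearr : forall x : L, linear (lie x);
  liexx : forall x, lie x x = 0;
  lie_jacobi : forall x y z,
    lie x (lie y z) + lie y (lie z x) + lie z (lie x y) = 0
}.

#[short(type="lieAlgType")]
HB.structure Definition LieAlgebra (K : fieldType) :=
  {L of isLieAlgebra K L & GRing.Lmodule K L}.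

Definition lie_isomorphic (K : fieldType) (L1 L2 : lieAlgType K) : Prop :=
  exists f : {linear L1 -> L2},
    bijective f /\ {morph f : x y / lie x y >-> lie x y}.

Section LieTheory.
Variables (K : fieldType) (L : lieAlgType K).
Implicit Types x y z : L.

Lemma lieDl x y z : lie (x + y) z = lie x z + lie y z.
Proof. by have := lie_linearl z 1 x y; rewrite !scale1r. Qed.

Lemma lieDr x y z : lie z (x + y) = lie z x + lie z y.
Proof. by have := lie_linearr z 1 x y; rewrite !scale1r. Qed.

Lemma lieC x y : lie x y = - lie y x.
Proof.
apply/eqP; rewrite -addr_eq0; apply/eqP.
by have := liexx (x + y); rewrite lieDl !lieDr !liexx add0r addr0.
Qed.

Lemma lieBl x y z : lie (x - y) z = lie x z - lie y z.
Proof.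
have := lie_linearl z (-1) y x; rewrite !scaleN1r => h.
by rewrite addrC h addrC.
Qed.

Lemma lieBr x y z : lie z (x - y) = lie z x - lie z y.
Proof. by rewrite lieC lieBl opprB [lie z x]lieC [lie z y]lieC opprK addrC. Qed.

End LieTheory.

HB.mixin Record isLieClosed (K : fieldType) (L : lieAlgType K)
    (S : L -> bool) := {
  rpred_lie : {in (S : {pred L}) &, forall x y, lie x y \in (S : {pred L})}
}.

#[short(type="lieSubClosed")]
HB.structure Definition LieSubClosed (K : fieldType) (L : lieAlgType K) :=
  {S of isLieClosed K L S & @GRing.SubmodClosed K L S}.

HB.mixin Record isLieAbsorbing (K : fieldType) (L : lieAlgType K)
    (I : L -> bool) := {
  rpred_lier : forall x y, y \in (I : {pred L}) -> lie x y \in (I : {pred L})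
}.

#[short(type="lieIdeal")]
HB.structure Definition LieIdeal (K : fieldType) (L : lieAlgType K) :=
  {I of isLieAbsorbing K L I & @GRing.SubmodClosed K L I}.

Section LieSub.
Variables (K : fieldType) (L : lieAlgType K) (S : lieSubClosed L).

Record lie_sub : predArgType :=
  LieSub { lie_subval :> L; _ : lie_subval \in S }.

HB.instance Definition _ := [isSub for lie_subval].
HB.instance Definition _ := [Choice of lie_sub by <:].
HB.instance Definition _ := [SubChoice_isSubLmodule of lie_sub by <:].

Definition lie_sub_lie (x y : lie_sub) : lie_sub :=
  LieSub (rpred_lie _ _ (valP x) (valP y)).

Lemma lie_sub_linearl (y : lie_sub) : linear (lie_sub_lie^~ y).
Proof. by move=> a u v; apply: val_inj; rewrite /= lie_linearl. Qed.

Lemma lie_sub_linearr (x : lie_sub) : linear (lie_sub_lie x).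
Proof. by move=> a u v; apply: val_inj; rewrite /= lie_linearr. Qed.

Lemma lie_sub_liexx (x : lie_sub) : lie_sub_lie x x = 0.
Proof. by apply: val_inj; rewrite /= liexx. Qed.

Lemma lie_sub_jacobi (x y z : lie_sub) :
  lie_sub_lie x (lie_sub_lie y z) + lie_sub_lie y (lie_sub_lie z x)
  + lie_sub_lie z (lie_sub_lie x y) = 0.
Proof. by apply: val_inj; rewrite /= lie_jacobi. Qed.

HB.instance Definition _ := isLieAlgebra.Build K lie_sub
  lie_sub_linearl lie_sub_linearr lie_sub_liexx lie_sub_jacobi.

End LieSub.

Section LieQuotient.
Variables (K : fieldType) (L : lieAlgType K) (I : lieIdeal L).

Lemma lie_ideal_zmod : zmod_closed I.
Proof.
split=> [|x y xI yI]; first exact: rpred0.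
by rewrite rpredD // -scaleN1r rpredZ.
Qed.

HB.instance Definition _ := GRing.isZmodClosed.Build L I lie_ideal_zmod.

Definition lie_quot := Quotient.quot I.

HB.instance Definition _ := GRing.Zmodule.on lie_quot.
HB.instance Definition _ :
  EqQuotient L (Quotient.equiv I) lie_quot := EqQuotient.on lie_quot.
HB.instance Definition _ := ZmodQuotient.on lie_quot.

Definition lquot_scale (a : K) := lift_op1 lie_quot ( *:%R a).
Definition lquot_lie := lift_op2 lie_quot (@lie K L).

Lemma lquot_pi_scale a :
  {morph \pi_lie_quot : x / a *: x >-> lquot_scale a x}.
Proof.
move=> x; unlock lquot_scale; apply/eqP.
rewrite piE Quotient.equivE -scalerBr rpredZ //.
by rewrite Quotient.idealrBE reprK.
Qed.

Lemma lquot_pi_lie :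
  {morph \pi_lie_quot : x y / lie x y >-> lquot_lie x y}.
Proof.
move=> x y; unlock lquot_lie; apply/eqP; rewrite piE Quotient.equivE.
set x' := repr _; set y' := repr _.
have xx' : x - x' \in I by rewrite Quotient.idealrBE reprK.
have yy' : y - y' \in I by rewrite Quotient.idealrBE reprK.
rewrite -[_ - _](addrNK (lie x' y)) -addrA [_ + lie x' y]addrC.
have -> : lie x y - lie x' y' + (lie x' y - lie x' y)
        = lie (x - x') y + lie x' (y - y').
  by rewrite lieBl lieBr subrr addr0 addrA addrNK.
apply: rpredD; last exact: rpred_lier.
by rewrite lieC rpredN; apply: rpred_lier.
Qed.

Canonical lquot_pi_scale_morph a := PiMorph1 (lquot_pi_scale a).
Canonical lquot_pi_lie_morph := PiMorph2 lquot_pi_lie.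

Lemma lquot_scaleA a b x :
  lquot_scale a (lquot_scale b x) = lquot_scale (a * b) x.
Proof. by rewrite -[x]reprK !piE scalerA. Qed.

Lemma lquot_scale1 : left_id 1 lquot_scale.
Proof. by move=> x; rewrite -[x]reprK !piE scale1r. Qed.

Lemma lquot_scaleDr : right_distributive lquot_scale +%R.
Proof.
by move=> a x y; rewrite -[x]reprK -[y]reprK !piE scalerDr.
Qed.

Lemma lquot_scaleDl x : {morph lquot_scale^~ x : a b / a + b}.
Proof. by move=> a b; rewrite -[x]reprK /= !piE scalerDl. Qed.

HB.instance Definition _ := GRing.Zmodule_isLmodule.Build K lie_quot
  lquot_scaleA lquot_scale1 lquot_scaleDr lquot_scaleDl.

Lemma lquot_scaleE a x :
  a *: (\pi_lie_quot x) = \pi_lie_quot (a *: x).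
Proof. by rewrite /GRing.scale /= piE. Qed.

Lemma lquot_addE x y :
  (\pi_lie_quot x) + (\pi_lie_quot y) = \pi_lie_quot (x + y).
Proof. by rewrite !piE. Qed.

Lemma lquot_linearl (y : lie_quot) : linear (lquot_lie^~ y).
Proof.
move=> a u v; rewrite -[u]reprK -[v]reprK -[y]reprK.
by rewrite -!lquot_pi_lie !lquot_scaleE !lquot_addE -lquot_pi_lie lie_linearl.
Qed.

Lemma lquot_linearr (x : lie_quot) : linear (lquot_lie x).
Proof.
move=> a u v; rewrite -[u]reprK -[v]reprK -[x]reprK.
by rewrite -!lquot_pi_lie !lquot_scaleE !lquot_addE -lquot_pi_lie lie_linearr.
Qed.

Lemma lquot_liexx (x : lie_quot) : lquot_lie x x = 0.
Proof. by rewrite -[x]reprK !piE liexx. Qed.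

Lemma lquot_jacobi (x y z : lie_quot) :
  lquot_lie x (lquot_lie y z) + lquot_lie y (lquot_lie z x)
  + lquot_lie z (lquot_lie x y) = 0.
Proof.
by rewrite -[x]reprK -[y]reprK -[z]reprK !piE lie_jacobi.
Qed.

HB.instance Definition _ := isLieAlgebra.Build K lie_quot
  lquot_linearl lquot_linearr lquot_liexx lquot_jacobi.

End LieQuotient.

Arguments lie_quot {K} L I.

Section MatrixLie.
Variables (K : fieldType) (n : nat).
Implicit Types A B C : 'M[K]_n.

Definition mx_lie A B : 'M[K]_n := A *m B - B *m A.

Lemma mx_lie_linearl B : linear (mx_lie^~ B).
Proof.
move=> a A C; rewrite /mx_lie mulmxDl mulmxDr -scalemxAl -scalemxAr.
by rewrite scalerBr opprD addrACA.
Qed.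

Lemma mx_lie_linearr A : linear (mx_lie A).
Proof.
move=> a B C; rewrite /mx_lie mulmxDl mulmxDr -scalemxAl -scalemxAr.
by rewrite scalerBr opprD addrACA.
Qed.

Lemma mx_liexx A : mx_lie A A = 0.
Proof. exact: subrr. Qed.

Lemma mx_lie_jacobi A B C :
  mx_lie A (mx_lie B C) + mx_lie B (mx_lie C A) + mx_lie C (mx_lie A B) = 0.
Proof.
rewrite /mx_lie !mulmxBl !mulmxBr !mulmxA !opprB.
set a := A *m B *m C; set b := A *m C *m B; set c := B *m A *m C.
set d := B *m C *m A; set e := C *m A *m B; set f := C *m B *m A.
by apply/matrixP=> i j; rewrite !mxE; ring.
Qed.

HB.instance Definition _ := isLieAlgebra.Build K 'M[K]_n
  mx_lie_linearl mx_lie_linearr mx_liexx mx_lie_jacobi.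

Definition so_pred : {pred 'M[K]_n} := [pred A | A^T == - A].

Lemma so_submod : submod_closed so_pred.
Proof.
split=> [|a A B]; rewrite !inE; first by rewrite trmx0 oppr0.
move=> /eqP hA /eqP hB.
by rewrite linearP /= hA hB scalerN opprD.
Qed.

Lemma so_lie : {in so_pred &, forall A B, lie A B \in so_pred}.
Proof.
move=> A B; rewrite !inE => /eqP hA /eqP hB.
rewrite /lie /= /mx_lie linearB /= !trmx_mul hA hB.
by rewrite !mulmxN !mulNmx !opprK opprB.
Qed.

HB.instance Definition _ := GRing.isSubmodClosed.Build K 'M[K]_n so_pred
  so_submod.
HB.instance Definition _ := isLieClosed.Build K 'M[K]_n so_pred so_lie.

End MatrixLie.

Definition so (K : fieldType) (n : nat) := lie_sub (@so_pred K n).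

Definition dotv (R : realType) p (u v : 'cV[R]_p) : R := (u^T *m v) 0 0.

Lemma dotvC (R : realType) p (u v : 'cV[R]_p) : dotv u v = dotv v u.
Proof. by rewrite /dotv -[in LHS](trmxK v) -trmx_mul mxE. Qed.

Section GradedDerivations.
Variables (R : realType) (m n : nat).

(* n_1 and n_2 are R^m and R^n with their standard orthonormal bases; the Lie
   bracket on their sum is determined by its restriction to n_1. *)
Record two_step := TwoStep {
  bracket :> {bilinear 'cV[R]_m -> 'cV[R]_m -> 'cV[R]_n};
  bracket_skew : forall X Y, bracket X Y = - bracket Y X
}.

(* [J mu Z] is the matrix of the operator J_mu(Z), acting on columns; its
   (i, j) entry is <J_mu(Z) X_j, X_i> = <mu(X_j, X_i), Z>. *)
Definition J (mu : two_step) (Z : 'cV[R]_n) : 'M[R]_m :=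
  \matrix_(i, j) dotv (mu (delta_mx j 0) (delta_mx i 0)) Z.

Lemma JP mu X Y Z : dotv (J mu Z *m X) Y = dotv (mu X Y) Z.
Proof.
have decomp p (v : 'cV[R]_p) : v = \sum_i v i 0 *: delta_mx i 0.
  by rewrite {1}[v]matrix_sum_delta; apply: eq_bigr => i _; rewrite big_ord1.
have dot_suml p q (V : 'I_p -> 'cV[R]_q) w :
    dotv (\sum_i V i) w = \sum_i dotv (V i) w.
  by rewrite /dotv linear_sum mulmx_suml summxE.
have dotZl q a (v w : 'cV[R]_q) : dotv (a *: v) w = a * dotv v w.
  by rewrite /dotv linearZ -scalemxAl mxE.
rewrite [in RHS](decomp _ X) linear_sumlz dot_suml {1}/dotv mxE.
under eq_bigr => i _ do rewrite !mxE mulr_suml.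
rewrite exchange_big; apply: eq_bigr => j _ /=.
rewrite linearZl_LR dotZl [in RHS](decomp _ Y) linear_sumr dot_suml mulr_sumr.
apply: eq_bigr => i _; rewrite linearZr_LR dotZl !mxE.
by ring.
Qed.

Lemma J_linear mu : linear (J mu).
Proof.
move=> a Y Z; apply/matrixP=> i j.
by rewrite !mxE /dotv mulmxDr -scalemxAr !mxE.
Qed.

Definition nonsingular (mu : two_step) : Prop :=
  forall Z, Z != 0 -> J mu Z \in unitmx.

Section Derivations.
Variable mu : two_step.

Definition der_gr_pred : {pred 'M[R]_(m + n)} :=
  [pred D | `[< exists (B : 'M[R]_m) (A : 'M[R]_n),
     [/\ D = block_mx B 0 0 A, \tr B = 0 &
         forall Z, B^T *m J mu Z + J mu Z *m B = J mu (A^T *m Z)] >]].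

Lemma der_gr_submod : submod_closed der_gr_pred.
Proof.
split=> [|a D E]; rewrite !inE.
  apply/asboolP; exists 0, 0; split; rewrite ?block_mx0 ?mxtrace0 // => Z.
  have := J_linear mu (-1) 0 0; rewrite scaler0 addr0 scaleN1r addNr => J0.
  by rewrite !trmx0 !mul0mx mulmx0 addr0 J0.
move=> /asboolP[B [A [-> trB hB]]] /asboolP[C [A' [-> trC hC]]].
apply/asboolP; exists (a *: B + C), (a *: A + A'); split.
- by rewrite scale_block_mx add_block_mx !scaler0 !addr0.
- by rewrite linearP /= trB trC mulr0 addr0.
move=> Z; rewrite [(_ + A')^T]linearP /= mulmxDl -scalemxAl J_linear -hB -hC.
rewrite linearP /= mulmxDl mulmxDr -scalemxAl -scalemxAr scalerDr.
by rewrite addrACA.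
Qed.

Lemma der_gr_lie : {in der_gr_pred &, forall D E, lie D E \in der_gr_pred}.
Proof.
move=> D E; rewrite !inE.
move=> /asboolP[B [A [-> trB hB]]] /asboolP[C [A' [-> trC hC]]].
apply/asboolP; exists (B *m C - C *m B), (A *m A' - A' *m A); split.
- rewrite /lie /= /mx_lie !mulmx_block !mulmx0 !mul0mx !addr0 !add0r.
  by rewrite opp_block_mx add_block_mx !subr0.
- by rewrite linearB /= [X in _ - X]mxtrace_mulC subrr.
move=> Z; have JB U V : J mu (U - V) = J mu U - J mu V.
  by rewrite [U - V]addrC -scaleN1r J_linear scaleN1r addrC.
rewrite [(A *m A' - _)^T]linearB /= !trmx_mul mulmxBl JB -!mulmxA.
rewrite -hC -!hB -hC linearB /= !trmx_mul.
rewrite !mulmxBl !mulmxBr !mulmxDl !mulmxDr !mulmxA.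
by apply/matrixP=> i j; rewrite !mxE; ring.
Qed.

HB.instance Definition _ := GRing.isSubmodClosed.Build R 'M[R]_(m + n)
  der_gr_pred der_gr_submod.
HB.instance Definition _ := isLieClosed.Build R 'M[R]_(m + n)
  der_gr_pred der_gr_lie.

Definition Der_gr := lie_sub der_gr_pred.

Definition Der_0 : {pred Der_gr} := [pred D | drsubmx (\val D) == 0].

Lemma Der_0_submod : submod_closed Der_0.
Proof.
split=> [|a D E]; rewrite !inE.
  by rewrite (raddf0 \val); apply/eqP/matrixP=> i j; rewrite !mxE.
move=> /eqP /matrixP hD /eqP /matrixP hE; rewrite (linearP \val).
apply/eqP/matrixP=> i j; move: (hD i j) (hE i j); rewrite !mxE => -> ->.
by rewrite mulr0 addr0.
Qed.

Lemma Der_0_lie D E : E \in Der_0 -> lie D E \in Der_0.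
Proof.
rewrite !inE; move: (valP D) (valP E); rewrite !inE /=.
move=> /asboolP[B [A [-> _ _]]] /asboolP[C [A' [-> _ _]]].
rewrite /lie /= /mx_lie !mulmx_block block_mxKdr => /eqP ->.
rewrite opp_block_mx add_block_mx block_mxKdr.
by rewrite !mulmx0 !mul0mx !addr0 subrr.
Qed.

HB.instance Definition _ := GRing.isSubmodClosed.Build R Der_gr Der_0
  Der_0_submod.
HB.instance Definition _ := isLieAbsorbing.Build R Der_gr Der_0 Der_0_lie.

End Derivations.

End GradedDerivations.

Arguments Der_0 {R m n} mu _.

Section MuS.
Variables (R : realType) (r : nat) (k : 'I_r -> nat).
Implicit Type z : 'cV[R]_2.

Definition mx22 (a b c d : R) : 'M[R]_2 :=
  block_mx a%:M b%:M c%:M d%:M : 'M[R]_(1 + 1).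

(* z is the vector x Z_1 + y Z_2; block indices are shifted by one because
   those of the text run from 1 to p. *)
Definition Ablock (p : nat) z : 'M[R]_(\sum_(i < p) 2) :=
  let x := z 0 0 in let y := z 1 0 in
  \mxblock_(i < p, j < p)
    if (i.+1 + j.+1 == p + 1)%N then mx22 (- x) y y x
    else if (i.+1 + j.+1 == p + 2)%N then mx22 0 x x 0
    else 0.

Definition Jblock (p : nat) z : 'M[R]_(\sum_(i < p) 2 + \sum_(i < p) 2) :=
  block_mx 0 (Ablock p z) (- (Ablock p z)^T) 0.

Lemma Ablock_linear p : linear (Ablock p).
Proof.
move=> a u v; apply/matrixP=> i j; rewrite !mxE.
have mx22P b c d e b' c' d' e' :
    a *: mx22 b c d e + mx22 b' c' d' e'
    = mx22 (a * b + b') (a * c + c') (a * d + d') (a * e + e').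
  apply/matrixP=> i' j'; rewrite !mxE.
  by case: split => i''; rewrite !mxE; case: split => j'';
    rewrite !mxE !ord1 eqxx !mulr1n.
case: ifP => _; last case: ifP => _; last by rewrite !mxE mulr0 addr0.
  by rewrite opprD -mulrN -mx22P !mxE.
have -> : mx22 0 (a * u 0 0 + v 0 0) (a * u 0 0 + v 0 0) 0
        = a *: mx22 0 (u 0 0) (u 0 0) 0 + mx22 0 (v 0 0) (v 0 0) 0.
  by rewrite mx22P mulr0 addr0.
by rewrite !mxE.
Qed.

Lemma Jblock_linear p : linear (Jblock p).
Proof.
move=> a u v; apply/matrixP=> i j; rewrite /Jblock Ablock_linear !mxE.
by case: split => i'; rewrite !mxE; case: split => j'; rewrite !mxE; ring.
Qed.

Lemma Jblock_skew p z : (Jblock p z)^T = - Jblock p z.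
Proof.
rewrite /Jblock tr_block_mx opp_block_mx.
by congr block_mx; apply/matrixP=> i j; rewrite !mxE ?oppr0 ?opprK.
Qed.

Lemma dim_JS :
  (\sum_(s < r) (\sum_(i < k s) 2 + \sum_(i < k s) 2) = 4 * \sum_(s < r) k s)%N.
Proof.
rewrite big_distrr /=; apply: eq_bigr => s _.
by rewrite sum_nat_const card_ord -mulnDr mulnC.
Qed.

(* The multiset {(i, k_1), ..., (i, k_r)} is given by the family k. *)
Definition JS z : 'M[R]_(4 * \sum_(s < r) k s) :=
  castmx (dim_JS, dim_JS) (\mxdiag_(s < r) Jblock (k s) z).

Lemma JS_skew z : (JS z)^T = - JS z.
Proof.
rewrite /JS trmx_cast tr_mxdiag (eq_mxdiag (fun s => Jblock_skew (k s) z)) /=.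
by rewrite mxdiagN; case: _ / dim_JS; rewrite !castmx_id.
Qed.

Let mxdiag_linear (p_ : 'I_r -> nat) a (B C D : forall s, 'M[R]_(p_ s)) :
  (forall s, D s = a *: B s + C s) -> mxdiag D = a *: mxdiag B + mxdiag C.
Proof.
move=> BCD; rewrite (eq_mxdiag BCD) mxdiagD; congr (_ + _).
apply/matrixP=> i j; rewrite !mxE; move: (tagnat.sig2 i) (tagnat.sig2 j).
case: eqVneq => [->|_] i' j'; first by rewrite !conform_mx_id !mxE.
by rewrite !mxE mulr0.
Qed.

Let castmx_linear p q (e : p = q) a (A B : 'M[R]_p) :
  castmx (e, e) (a *: A + B) = a *: castmx (e, e) A + castmx (e, e) B.
Proof. by case: _ / e; rewrite !castmx_id. Qed.

Lemma JS_linear : linear JS.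
Proof.
move=> a u v; rewrite /JS -castmx_linear; congr castmx.
by apply: mxdiag_linear => s; apply: Jblock_linear.
Qed.

Let m := (4 * \sum_(s < r) k s)%N.

(* mu is recovered from J by mu(X, Y) = sum_l <J(Z_l) X, Y> Z_l. *)
Definition mu_S_bracket (X Y : 'cV[R]_m) : 'cV[R]_2 :=
  \col_l dotv (JS (delta_mx l 0) *m X) Y.

Lemma mu_S_bilinear : bilinear_for *:%R *:%R mu_S_bracket.
Proof.
split=> [Y|X] a u v; apply/colP => l; rewrite !mxE /dotv.
  by rewrite mulmxDr -scalemxAr linearP /= mulmxDl -scalemxAl !mxE.
by rewrite mulmxDr -scalemxAr !mxE.
Qed.

HB.instance Definition _ := bilinear_isBilinear.Build R 'cV[R]_m 'cV[R]_m
  'cV[R]_2 *:%R *:%R mu_S_bracket mu_S_bilinear.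

Lemma mu_S_skew X Y : mu_S_bracket X Y = - mu_S_bracket Y X.
Proof.
apply/colP=> l; rewrite !mxE [in RHS]dotvC /dotv trmx_mul JS_skew.
by rewrite mulmxN mulNmx mxE mulmxA.
Qed.

Definition mu_S : two_step R m 2 := TwoStep mu_S_skew.

Let linear_cV2 (V : lmodType R) (f : 'cV[R]_2 -> V) : linear f ->
  forall z, f z = z 0 0 *: f (delta_mx 0 0) + z 1 0 *: f (delta_mx 1 0).
Proof.
move=> f_lin z.
have f0 : f 0 = 0.
  by have := f_lin (-1) 0 0; rewrite scaler0 addr0 scaleN1r addNr.
have {1}-> : z = z 0 0 *: delta_mx 0 0 + (z 1 0 *: delta_mx 1 0 + 0).
  apply/colP=> l; rewrite !mxE !eqxx !andbT addr0.
  by case: l => [[|[|l]] hl] //=; rewrite mulr1 mulr0 ?addr0 ?add0r;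
    congr (z _ _); apply: val_inj.
by rewrite !f_lin f0 addr0.
Qed.

Let dotv_matrix p q (M : 'I_q -> 'M[R]_p) (z : 'cV[R]_q) :
  \matrix_(i, j) dotv
    (\col_l dotv (M l *m delta_mx j 0) (delta_mx i 0 : 'cV[R]_p)) z
  = \sum_l z l 0 *: M l.
Proof.
have dotE N i j : dotv (N *m delta_mx j 0) (delta_mx i 0 : 'cV[R]_p) = N i j.
  rewrite -colE /dotv mxE (bigD1 i) //= !mxE !eqxx mulr1 big1 ?addr0 //.
  by move=> l /negPf il; rewrite !mxE il mulr0.
apply/matrixP=> i j; rewrite mxE summxE {1}/dotv mxE; apply: eq_bigr => l _.
by rewrite 2!mxE dotE mxE mulrC.
Qed.

Lemma J_mu_S z : J mu_S z = JS z.
Proof.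
apply: etrans (dotv_matrix (fun l => JS (delta_mx l 0)) z) _.
apply: etrans (esym (linear_cV2 JS_linear z)); rewrite big_ord_recl big_ord1.
by congr (_ + z _ _ *: JS (delta_mx _ _)); apply: val_inj.
Qed.

Lemma mu_SP X Y Z : dotv (JS Z *m X) Y = dotv (mu_S X Y) Z.
Proof. by rewrite -J_mu_S JP. Qed.

End MuS.

(* Main.v *)
(** Up to a fixed invertible factor the off-diagonal block of J(x Z_1 + y Z_2)
    is y + x T, where T = I + N is the real Jordan block with eigenvalue i.
    It is invertible for (x, y) <> 0, since y + x I is and N is nilpotent.
    The rotation (x, y) |-> (-y, x) is the infinitesimal Moebius transformation
    fixing i, so it is induced by a graded derivation: the equations reduce to
    [T, M] = 1 + T^2 = N (2 I + N), solved by M = H (2 I + N) with [N, H] = N.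
    Conversely, a derivation (B, A) satisfies tr(J(z)^-1 J(A^T z)) = 2 tr B = 0;
    as this trace vanishes for the rotation, the component of A^T z along z is
    zero, and hence A is skew. *)

From HB Require Import structures.
Require Import Defs.
From mathcomp Require Import all_boot all_order all_algebra.
From mathcomp Require Import ring lra zify.
From mathcomp Require Import boolp reals.

Set Implicit Arguments.
Unset Strict Implicit.
Unset Printing Implicit Defensive.

Import Order.TTheory GRing.Theory Num.Theory.

Local Open Scope ring_scope.
Local Open Scope quotient_scope.

(** First isomorphism theorem. The set-theoretic section [g] supplies surjectivity: followed by the
    projection, it inverts the induced map. *)
Lemma lie_quot_isomorphic (K : fieldType) (L L' : lieAlgType K)
    (I : lieIdeal L) (f : {linear L -> L'}) (g : L' -> L) :
  {morph f : x y / lie x y} -> (forall x, (x \in I) = (f x == 0)) ->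
  cancel g f -> lie_isomorphic (lie_quot L I) L'.
Proof.
move=> f_lie fI gK.
pose h (q : lie_quot L I) : L' := f (repr q).
have hE x : h (\pi_(lie_quot L I) x) = f x.
  apply/eqP; rewrite eq_sym -subr_eq0 -linearB -fI.
  by rewrite Quotient.idealrBE reprK.
have h_lin : linear h.
  move=> a u v; rewrite -[u]reprK -[v]reprK lquot_scaleE lquot_addE !hE.
  by rewrite linearP.
pose hL : {linear lie_quot L I -> L'} :=
  HB.pack h (GRing.isLinear.Build K _ _ _ h h_lin).
exists hL; split.
  exists (fun y => \pi_(lie_quot L I) (g y)) => [q|y] /=; last by rewrite hE gK.
  rewrite -[q in RHS]reprK; apply/eqP.
  by rewrite -Quotient.idealrBE fI linearB /= gK /h subrr.
move=> u v /=; rewrite -[u]reprK -[v]reprK !hE -f_lie -hE.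
by rewrite lquot_pi_lie.
Qed.

(** * Graded derivations over a two-dimensional centre *)

Section TwoDimensionalCenter.
Variables (R : realType) (m : nat) (mu : two_step R m 2).

Let ord2 (i : 'I_2) : i = 0 \/ i = 1.
Proof. by case: i => -[|[|i]] hi //; [left|right]; apply: val_inj. Qed.

(** A generator of so(2), oriented so that its transpose, which enters the derivation equation, is
    the quarter turn (x, y) |-> (-y, x). *)
Definition rot : 'M[R]_2 := \matrix_(i, j) ((i < j)%:R - (j < i)%:R).

Lemma rotTE (z : 'cV[R]_2) :
  ((rot^T *m z) 0 0 = - z 1 0) * ((rot^T *m z) 1 0 = z 0 0).
Proof.
split; rewrite mxE !big_ord_recl big_ord0 !mxE /=.
  by rewrite (_ : lift _ _ = 1); [ring | apply: val_inj].
by rewrite (_ : lift _ _ = 1); [ring | apply: val_inj].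
Qed.

Lemma colP2 (T : Type) (u v : 'cV[T]_2) :
  u 0 0 = v 0 0 -> u 1 0 = v 1 0 -> u = v.
Proof. by move=> uv0 uv1; apply/colP => i; case: (ord2 i) => ->. Qed.

Lemma so2E (M : 'M[R]_2) :
  (M \in @so_pred R 2) =
  [&& M 0 0 == 0, M 1 1 == 0 & M 1 0 == - M 0 1].
Proof.
rewrite inE; apply/eqP/and3P => [/matrixP MT|[/eqP M0 /eqP M1 /eqP M01]].
  have := MT 0 0; have := MT 1 1; have := MT 0 1; rewrite !mxE => -> h1 h0.
  by split=> //; apply/eqP; lra.
apply/matrixP => i j; rewrite !mxE.
by case: (ord2 i) (ord2 j) => -> [] ->; rewrite ?M0 ?M1 ?M01 ?oppr0 ?opprK.
Qed.

Lemma dot_skew (A : 'M[R]_2) :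
  (forall z, z != 0 -> dotv z (A^T *m z) = 0) -> A \in @so_pred R 2.
Proof.
move=> zAz.
have E (x y : R) : x != 0 \/ y != 0 ->
    x * (A 0 0 * x + A 1 0 * y) + y * (A 0 1 * x + A 1 1 * y) = 0.
  move=> xy; pose z : 'cV[R]_2 := \col_i (if i == 0 then x else y).
  have z0 : z != 0.
    apply/eqP => /colP hz; have := hz 0; have := hz 1.
    by rewrite !mxE /= => hy hx; case: xy; rewrite ?hx ?hy eqxx.
  rewrite -[RHS](zAz z z0) /dotv mxE !big_ord_recl big_ord0 !mxE.
  rewrite !big_ord_recl !big_ord0 !mxE /= (_ : lift _ _ = 1);
    last exact: val_inj.
  by rewrite !addr0.
rewrite so2E.
(* The vectors (1, 0) and (0, 1) give the diagonal entries, and (1, 1) the sum of the other two. *)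
have := E 1 0 (or_introl (oner_neq0 _)).
have := E 0 1 (or_intror (oner_neq0 _)).
have := E 1 1 (or_intror (oner_neq0 _)).
by move=> h h1 h2; apply/and3P; split; apply/eqP; lra.
Qed.

Lemma der_gr_trace (B : 'M[R]_m) (A : 'M[R]_2) z :
  \tr B = 0 -> B^T *m J mu z + J mu z *m B = J mu (A^T *m z) ->
  J mu z \in unitmx -> \tr (invmx (J mu z) *m J mu (A^T *m z)) = 0.
Proof.
move=> trB <- Jz; rewrite mulmxDr linearD /= mulKmx // trB addr0.
by rewrite mulmxA mxtrace_mulC mulmxA mulmxV // mul1mx mxtrace_tr.
Qed.

Hypotheses (m_gt0 : (0 < m)%N) (mu_nonsing : nonsingular mu).
Variable B0 : 'M[R]_m.
Hypotheses (trB0 : \tr B0 = 0)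
  (B0P : forall z, B0^T *m J mu z + J mu z *m B0 = J mu (rot^T *m z)).

(* In the basis z, rot^T z of the plane only the component of A^T z along z
   contributes to tr(J(z)^-1 J(A^T z)), since rot is induced by B0. *)
Lemma der_gr_skew (B : 'M[R]_m) (A : 'M[R]_2) :
  \tr B = 0 -> (forall z, B^T *m J mu z + J mu z *m B = J mu (A^T *m z)) ->
  A \in @so_pred R 2.
Proof.
move=> trB BP; apply: dot_skew => z z0; have Jz := mu_nonsing z0.
pose z' := rot^T *m z.
have dotE (u v : 'cV[R]_2) : dotv u v = u 0 0 * v 0 0 + u 1 0 * v 1 0.
  rewrite /dotv mxE !big_ord_recl big_ord0 !mxE addr0.
  by rewrite (_ : lift _ _ = 1) //; apply: val_inj.
(* [z] and [z'] are orthogonal of equal length; scaling [w] avoids a division. The final [0] lets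
   [J_linear] treat both summands. *)
have decomp w : dotv z z *: w = dotv z w *: z + (dotv z' w *: z' + 0).
  have [] := rotTE z; rewrite -/z'; move: z' => u u0 u1.
  by apply: colP2; rewrite !mxE !dotE u0 u1; ring.
have J0 : J mu 0 = 0.
  by have := J_linear mu (-1) 0 0; rewrite scaler0 addr0 scaleN1r addNr.
have JZ a u : J mu (a *: u) = a *: J mu u.
  by have := J_linear mu a u 0; rewrite J0 !addr0.
have := congr1 (fun u => \tr (invmx (J mu z) *m J mu u)) (decomp (A^T *m z)).
rewrite !J_linear J0 addr0 JZ mulmxDr -!scalemxAr linearD /= !mxtraceZ.
rewrite (der_gr_trace trB (BP z) Jz) (der_gr_trace trB0 (B0P z) Jz) !mulr0.
(* The trace of the identity leaves <z, A^T z> m = 0, where m is positive. *)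
rewrite addr0 mulVmx // mxtrace1 => /esym/eqP.
by rewrite mulf_eq0 pnatr_eq0 (gtn_eqF m_gt0) orbF => /eqP.
Qed.

(** The projection of a derivation to its block A has kernel [Der_0], lands in so(2) by
    [der_gr_skew], and is onto because [rot], induced by [B0], spans so(2). *)
Lemma der_gr_so2 :
  lie_isomorphic (lie_quot (Der_gr mu) (Der_0 mu)) (so R 2).
Proof.
have Dso (D : Der_gr mu) : drsubmx (\val D) \in @so_pred R 2.
  have := valP D; rewrite inE => /asboolP[B [A [-> trB BP]]].
  by rewrite block_mxKdr; apply: der_gr_skew BP.
pose f (D : Der_gr mu) : so R 2 := LieSub (Dso D).
have f_lin : linear f.
  move=> a D E; apply: val_inj; rewrite [RHS](linearP \val).
  have -> : \val (f (a *: D + E)) = drsubmx (\val (a *: D + E)) by [].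
  by rewrite (linearP \val); apply/matrixP => i j; rewrite !mxE.
pose fL : {linear Der_gr mu -> so R 2} :=
  HB.pack f (GRing.isLinear.Build R _ _ _ f f_lin).
have gP (M : so R 2) : (\val M) 0 1 *: block_mx B0 0 0 rot \in der_gr_pred mu.
  by apply: rpredZ; rewrite inE; apply/asboolP; exists B0, rot.
pose g (M : so R 2) : Der_gr mu := LieSub (gP M).
apply: (@lie_quot_isomorphic _ _ _ _ fL g).
- move=> D E; apply: val_inj => /=; have := valP D; have := valP E.
  rewrite !inE => /asboolP[B [A [-> _ _]]] /asboolP[C [A' [-> _ _]]].
  rewrite /lie /= /mx_lie !mulmx_block opp_block_mx add_block_mx.
  by rewrite !block_mxKdr !mul0mx !add0r.
- by move=> D.
move=> M; apply: val_inj => /=; have := valP M; rewrite so2E.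
move=> /and3P[/eqP M0 /eqP M1 /eqP M01].
rewrite scale_block_mx block_mxKdr; apply/matrixP => i j; rewrite !mxE.
case: (ord2 i) (ord2 j) => -> [] -> /=.
- by rewrite subrr mulr0; exact: esym M0.
- by rewrite subr0 mulr1.
- by rewrite sub0r mulrN1; exact: esym M01.
by rewrite subrr mulr0; exact: esym M1.
Qed.

End TwoDimensionalCenter.

(** * Kronecker products with 2 x 2 matrices *)

Section KroneckerBlocks.
Variables (R : realType) (p : nat).
Implicit Types (X : 'M[R]_p) (Y : 'M[R]_2).

(** The Kronecker product of X and Y, with the block sizes of [Ablock] so that both have the same
    type. *)
Definition kblock X Y : 'M[R]_(\sum_(i < p) 2) :=
  \mxblock_(i < p, j < p) (X i j *: Y).

Lemma kblockM X Y X' Y' :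
  kblock X Y *m kblock X' Y' = kblock (X *m X') (Y *m Y').
Proof.
rewrite mul_mxblock; apply: eq_mxblock => i j; rewrite mxE scaler_suml.
by apply: eq_bigr => l _; rewrite -scalemxAl -scalemxAr scalerA.
Qed.

Lemma kblockZr a X Y : a *: kblock X Y = kblock X (a *: Y).
Proof. by apply/matrixP => i j; rewrite !mxE; ring. Qed.

Lemma kblockDl X X' Y : kblock (X + X') Y = kblock X Y + kblock X' Y.
Proof. by apply/matrixP => i j; rewrite !mxE; ring. Qed.

Lemma kblock0l Y : kblock 0 Y = 0.
Proof. by apply/matrixP => i j; rewrite !mxE mul0r. Qed.

Lemma kblock_scalar a : kblock 1%:M a%:M = a%:M.
Proof.
rewrite -mxdiagZ; apply: eq_mxblock => i j; rewrite mxE.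
by case: eqVneq; rewrite ?conform_mx_id ?scale1r ?scale0r.
Qed.

Lemma mxtrace_kblock X Y : \tr (kblock X Y) = \tr X * \tr Y.
Proof.
by rewrite mxtrace_mxblock mulr_suml; apply: eq_bigr => i _; rewrite mxtraceZ.
Qed.

Lemma kblockX X l : kblock X 1%:M ^+ l = kblock (X ^+ l) 1%:M.
Proof.
elim: l => [|l IHl]; first by rewrite !expr0 [RHS]kblock_scalar.
by rewrite !exprS IHl [LHS]kblockM mulmx1.
Qed.

Definition shift_mx : 'M[R]_p := \matrix_(i, j) (j == i.+1 :> nat)%:R.
Definition flip_mx : 'M[R]_p := \matrix_(i, j) (j == rev_ord i)%:R.
Definition grade_mx : 'M[R]_p := diag_mx (\row_i i%:R).

(** The entry (i, j) of the l-th power vanishes for j < i + l, and every column index is below i +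
    p. *)
Lemma shift_mx_nilp : shift_mx ^+ p = 0.
Proof.
have shift0 l (i j : 'I_p) : (j < i + l)%N -> (shift_mx ^+ l) i j = 0.
  elim: l i => [|l IHl] i.
    by rewrite addn0 expr0 mxE; case: eqVneq => // ->; rewrite ltnn.
  move=> ji; rewrite exprS mxE big1 // => h _; rewrite mxE.
  case: eqP => [hi|_]; last by rewrite mul0r.
  by rewrite IHl ?mulr0 // hi addSnnS.
by apply/matrixP => i j; rewrite mxE shift0 // ltn_addl.
Qed.

Lemma flip_mul X i j : (flip_mx *m X) i j = X (rev_ord i) j.
Proof.
rewrite mxE (bigD1 (rev_ord i)) //= mxE eqxx mul1r big1 ?addr0 // => l.
by rewrite mxE => /negPf ->; rewrite mul0r.
Qed.

Lemma flip_mxK : flip_mx *m flip_mx = 1%:M.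
Proof.
by apply/matrixP => i j; rewrite flip_mul !mxE rev_ordK eq_sym.
Qed.

(** The entry at (i, i + 1) is weighted by i + 1 on the right and by i on the left; the difference
    is the shift itself. *)
Lemma shift_grade_mx :
  shift_mx *m grade_mx = grade_mx *m shift_mx + shift_mx.
Proof.
rewrite mul_mx_diag mul_diag_mx; apply/matrixP => i j; rewrite !mxE.
by case: eqP => [->|_]; rewrite ?mul0r ?mulr0 ?addr0 // mul1r mulr1 -natr1.
Qed.

Lemma mxtrace_shift_mx : \tr shift_mx = 0.
Proof. by rewrite /mxtrace big1 // => i _; rewrite mxE ltn_eqF. Qed.

End KroneckerBlocks.

Section Mx22.
Variable R : realType.
Implicit Types a b c d : R.

Lemma mx22M a b c d a' b' c' d' :
  mx22 a b c d *m mx22 a' b' c' d' =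
  mx22 (a * a' + b * c') (a * b' + b * d') (c * a' + d * c') (c * b' + d * d').
Proof. by rewrite [LHS](@mulmx_block _ 1 1 1 1 1 1) -!scalar_mxM -!raddfD. Qed.

Lemma mx22D a b c d a' b' c' d' :
  mx22 a b c d + mx22 a' b' c' d' = mx22 (a + a') (b + b') (c + c') (d + d').
Proof. by rewrite [LHS](@add_block_mx _ 1 1 1 1) -!raddfD. Qed.

Lemma mx22Z e a b c d :
  e *: mx22 a b c d = mx22 (e * a) (e * b) (e * c) (e * d).
Proof. by rewrite [LHS](@scale_block_mx _ 1 1 1 1) !scale_scalar_mx. Qed.

Lemma mx22_scalar a : a%:M = mx22 a 0 0 a :> 'M[R]_2.
Proof. by rewrite [LHS](@scalar_mx_block _ 1 1) /mx22 raddf0. Qed.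

Lemma mxtrace_mx22 a b c d : \tr (mx22 a b c d) = a + d.
Proof. by rewrite [LHS](@mxtrace_block _ 1 1) !mxtrace_scalar !mulr1n. Qed.

End Mx22.

Lemma complex_mul_conj (K : fieldType) q (x y : K) (I : 'M[K]_q) :
  I *m I = - 1%:M ->
  (y%:M + x *: I) *m (y%:M - x *: I) = (x ^+ 2 + y ^+ 2)%:M.
Proof.
move=> II; rewrite mulmxBr !mulmxDl -!scalemxAr -!scalemxAl II.
rewrite !mul_scalar_mx !mul_mx_scalar.
by apply/matrixP => i j; rewrite !mxE; ring.
Qed.

(** * The real Jordan block with eigenvalue i *)

Section JordanBlock.
Variables (R : realType) (p : nat).

(** I, N, T and H of the outline are [imag_mx], [nilp_mx], [jordan_mx] and [level_mx]; [swap_mx] is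
    the fixed invertible factor. *)
Definition imag_mx : 'M[R]_(\sum_(i < p) 2) := kblock 1%:M (mx22 0 1 (-1) 0).
Definition nilp_mx : 'M[R]_(\sum_(i < p) 2) := kblock (shift_mx R p) 1%:M.
Definition jordan_mx := imag_mx + nilp_mx.
Definition swap_mx : 'M[R]_(\sum_(i < p) 2) :=
  kblock (flip_mx R p) (mx22 0 1 1 0).
Definition level_mx : 'M[R]_(\sum_(i < p) 2) := kblock (grade_mx R p) 1%:M.

Lemma imag_sqr : imag_mx *m imag_mx = - 1%:M.
Proof.
rewrite kblockM mul1mx mx22M !mul0r !mulr0 mul1r mulr1 !addr0 ?add0r.
by rewrite -mx22_scalar kblock_scalar raddfN.
Qed.

Lemma imag_nilp : imag_mx *m nilp_mx = nilp_mx *m imag_mx.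
Proof. by rewrite !kblockM !mul1mx !mulmx1. Qed.

Lemma imag_level : imag_mx *m level_mx = level_mx *m imag_mx.
Proof. by rewrite !kblockM !mul1mx !mulmx1. Qed.

Lemma nilp_level : nilp_mx *m level_mx = level_mx *m nilp_mx + nilp_mx.
Proof. by rewrite !kblockM shift_grade_mx mulmx1 kblockDl. Qed.

Lemma nilp_mxX : nilp_mx ^+ p = 0.
Proof. by rewrite kblockX shift_mx_nilp kblock0l. Qed.

Lemma swap_mxK : swap_mx *m swap_mx = 1%:M.
Proof.
rewrite kblockM flip_mxK mx22M !mul0r !mulr0 mul1r !addr0 !add0r.
by rewrite -mx22_scalar kblock_scalar.
Qed.

Lemma mxtrace_jordan : \tr jordan_mx = 0.
Proof.
rewrite linearD /= !mxtrace_kblock mxtrace_shift_mx mul0r mxtrace_mx22.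
by rewrite !addr0 mulr0.
Qed.

(** Reversing the block rows carries the diagonal and the superdiagonal of T to the antidiagonals i
    + j = p + 1 and i + j = p + 2, counted from one. *)
Lemma Ablock_factor z :
  Ablock p z = swap_mx *m ((z 1 0)%:M + z 0 0 *: jordan_mx).
Proof.
rewrite scalerDr !mulmxDr mul_mx_scalar -!scalemxAr !kblockM !mulmx1.
rewrite mx22M !kblockZr !mx22Z addrA -!mxblockD /Ablock.
apply: eq_mxblock => i j; rewrite flip_mul !mxE -!(inj_eq val_inj) /=.
(* [p - i.+1] is the value of [rev_ord i]; the subtraction is exact since i < p. *)
have -> : (i.+1 + j.+1 == p + 1)%N = (j == p - i.+1 :> nat)%N.
  by have := ltn_ord i; lia.
have -> : (i.+1 + j.+1 == p + 2)%N = (j == (p - i.+1).+1 :> nat)%N.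
  by have := ltn_ord i; lia.
case: eqP => [->|_].
  rewrite ltn_eqF // scale0r addr0 !scale1r mx22D.
  by congr mx22; ring.
case: ifP => _; rewrite !scale0r !add0r ?scale1r //.
by congr mx22; ring.
Qed.

(* The nilpotent part disappears in the p-th power, and x - y divides
   x^p - y^p for commuting x and y. *)
Lemma jordan_unitmx x y :
  x != 0 \/ y != 0 -> y%:M + x *: jordan_mx \in unitmx.
Proof.
move=> xy.
have nrm0 : x ^+ 2 + y ^+ 2 != 0.
  rewrite paddr_eq0 ?sqr_ge0 // !sqrf_eq0.
  by apply/negP => /andP[/eqP x0 /eqP y0]; case: xy; rewrite ?x0 ?y0 eqxx.
pose a := y%:M + x *: imag_mx.
pose a' := (x ^+ 2 + y ^+ 2)^-1 *: (y%:M - x *: imag_mx).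
have aa' : a * a' = 1.
  rewrite -[LHS]/(a *m a') /a' -scalemxAr complex_mul_conj ?imag_sqr //.
  by rewrite scale_scalar_mx mulVf.
have a'a : a' * a = 1 by apply: mulmx1C.
(* The sign makes [a - b] equal to y + x T. *)
pose b : 'M_(\sum_(i < p) 2) := (- x)%:M * nilp_mx.
have comm_ab : GRing.comm a b.
  apply: commrM; first exact: scalar_mxC.
  apply/commr_sym/commrD; first exact: scalar_mxC.
  rewrite /GRing.comm -[LHS]/(_ *m _) -[RHS]/(_ *m _).
  by rewrite -scalemxAr -imag_nilp scalemxAl.
have b_nilp : b ^+ p = 0.
  rewrite exprMn_comm ?nilp_mxX ?mulr0 //; exact: esym (scalar_mxC _ _).
have factor : a ^+ p = (a - b) * \sum_(i < p) a ^+ (p.-1 - i) * b ^+ i.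
  by rewrite -subrXX_comm // b_nilp subr0.
have -> : y%:M + x *: jordan_mx = a - b.
  rewrite /b -[_ * nilp_mx]/(_ *m nilp_mx) mul_scalar_mx scaleNr opprK.
  by rewrite scalerDr addrA.
have [] // := @mulmx1_unit _ _ (a - b)
  ((\sum_(i < p) a ^+ (p.-1 - i) * b ^+ i) * a' ^+ p).
rewrite -[LHS]/((a - b) * _) mulrA -factor -exprMn_comm ?aa' ?expr1n //.
by rewrite /GRing.comm aa'.
Qed.

(* B2 solves [jordan_mx, B2] = 1 + jordan_mx^2; the right-hand side is
   N(2 I + N) for I = imag_mx and N = nilp_mx, and [N, level_mx] = N. *)
Lemma jordan_rotation :
  exists B1 B2 : 'M[R]_(\sum_(i < p) 2),
    \tr B1 + \tr B2 = 0 /\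
    forall x y, B1 *m (y%:M + x *: jordan_mx) + (y%:M + x *: jordan_mx) *m B2
                = x%:M - y *: jordan_mx.
Proof.
pose B2 := level_mx *m (imag_mx + jordan_mx).
(* The coefficient of y forces B1 + B2 = - T, which has trace zero; that of x then becomes [T, B2] =
   1 + T^2. *)
exists (- jordan_mx - B2), B2; split.
  by rewrite -linearD /= subrK linearN /= mxtrace_jordan oppr0.
move=> x y.
have B2P : jordan_mx *m B2 = B2 *m jordan_mx + jordan_mx *m jordan_mx + 1%:M.
  have TG : jordan_mx *m level_mx = level_mx *m jordan_mx + nilp_mx.
    by rewrite mulmxDl imag_level nilp_level addrA -mulmxDr.
  have TI : jordan_mx *m imag_mx = imag_mx *m jordan_mx.
    by rewrite mulmxDl mulmxDr imag_nilp.
  have NT : nilp_mx *m (imag_mx + jordan_mx) = jordan_mx *m jordan_mx + 1%:M.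
    rewrite /jordan_mx !(mulmxDl, mulmxDr) imag_sqr imag_nilp.
    move: (nilp_mx *m imag_mx) (nilp_mx *m nilp_mx) => P Q.
    by apply/matrixP => i j; rewrite !mxE; ring.
  rewrite /B2 mulmxA TG mulmxDl NT addrA -!mulmxA; congr (_ *m _ + _ + _).
  by rewrite [LHS]mulmxDr [RHS]mulmxDl TI.
rewrite [X in X + _]mulmxDr [X in _ + X]mulmxDl -scalemxAr -scalemxAl B2P.
rewrite !mulmxBl !mulNmx mul_scalar_mx !mul_mx_scalar.
move: B2 (jordan_mx *m jordan_mx) (B2 *m jordan_mx) jordan_mx {B2P}.
move=> B P Q T.
by apply/matrixP => i j; rewrite !mxE; ring.
Qed.

Lemma Ablock_unitmx (z : 'cV[R]_2) : z != 0 -> Ablock p z \in unitmx.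
Proof.
move=> z0; rewrite Ablock_factor unitmx_mul.
have [-> _] := mulmx1_unit swap_mxK; apply: jordan_unitmx.
have [x0|] := eqVneq (z 0 0) 0; [right|by left].
by apply: contra_neq z0 => y0; apply: colP2; rewrite ?x0 ?y0 mxE.
Qed.

Lemma Ablock_rotation :
  exists B1 B2 : 'M[R]_(\sum_(i < p) 2),
    \tr B1 + \tr B2 = 0 /\
    forall z, B1^T *m Ablock p z + Ablock p z *m B2
              = Ablock p ((rot R)^T *m z).
Proof.
have [B1 [B2 [trB BP]]] := jordan_rotation.
(* Conjugation by the involution [swap_mx] moves B1 past the left factor of [Ablock_factor] and
   keeps its trace. *)
exists (swap_mx *m B1 *m swap_mx)^T, B2; split.
  by rewrite mxtrace_tr mxtrace_mulC mulmxA swap_mxK mul1mx.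
move=> z; rewrite trmxK !Ablock_factor -!mulmxA.
rewrite [swap_mx *m (swap_mx *m _)]mulmxA swap_mxK mul1mx -mulmxDr BP.
by rewrite !rotTE scaleNr.
Qed.

Lemma Jblock_unitmx (z : 'cV[R]_2) : z != 0 -> Jblock p z \in unitmx.
Proof.
move=> /Ablock_unitmx Az; have ATz : (Ablock p z)^T \in unitmx.
  by rewrite unitmx_tr.
have [] // := @mulmx1_unit _ _ (Jblock p z)
  (block_mx 0 (- invmx (Ablock p z)^T) (invmx (Ablock p z)) 0).
rewrite mulmx_block !mulmx0 !mul0mx mulmxN mulNmx opprK !mulmxV // !addr0 add0r.
by rewrite -scalar_mx_block.
Qed.

(** For B = diag(B1, B2) the upper right block of B^T J + J B is B1^T A + A B2, and the lower left
    one is its negative transpose, so one equation suffices. *)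
Lemma Jblock_rotation :
  exists B : 'M[R]_(\sum_(i < p) 2 + \sum_(i < p) 2),
    \tr B = 0 /\
    forall z, B^T *m Jblock p z + Jblock p z *m B
              = Jblock p ((rot R)^T *m z).
Proof.
have [B1 [B2 [trB BP]]] := Ablock_rotation.
exists (block_mx B1 0 0 B2); rewrite mxtrace_block; split=> // z.
rewrite /Jblock -BP tr_block_mx !trmx0 !mulmx_block add_block_mx.
rewrite !mulmx0 !mul0mx !addr0 !add0r; congr block_mx.
by rewrite linearD /= !trmx_mul trmxK mulmxN mulNmx opprD addrC.
Qed.

End JordanBlock.

(** * Block diagonal matrices *)

Section BlockDiagonal.
Variables (K : fieldType) (r : nat) (p_ : 'I_r -> nat).

Lemma mxdiagM (A B : forall s, 'M[K]_(p_ s)) :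
  mxdiag A *m mxdiag B = mxdiag (fun s => A s *m B s).
Proof.
rewrite [mxdiag B]/mxdiag mul_mxdiag_mxblock; apply: eq_mxblock => i j.
by case: eqVneq => [<-|_]; rewrite ?conform_mx_id ?mulmx0.
Qed.

Lemma mxdiag_unitmx (A : forall s, 'M[K]_(p_ s)) :
  (forall s, A s \in unitmx) -> mxdiag A \in unitmx.
Proof.
move=> uA; have [] // := @mulmx1_unit _ _ (mxdiag A)
  (mxdiag (fun s => invmx (A s))).
rewrite mxdiagM -mxdiagZ; apply: eq_mxdiag => s; exact: mulmxV.
Qed.

End BlockDiagonal.

Section JS.
Variables (R : realType) (r : nat) (k : 'I_r -> nat).

Lemma JS_unitmx (z : 'cV[R]_2) : z != 0 -> JS k z \in unitmx.
Proof.
move=> z0; have := mxdiag_unitmx (fun s => Jblock_unitmx (k s) z0).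
by rewrite /JS; case: _ / dim_JS; rewrite castmx_id.
Qed.

(** Every block is rotated by the same [rot], whatever its size, so the blockwise solutions combine
    into a single block diagonal one. *)
Lemma JS_rotation :
  exists B : 'M[R]_(4 * \sum_(s < r) k s),
    \tr B = 0 /\
    forall z, B^T *m JS k z + JS k z *m B = JS k ((rot R)^T *m z).
Proof.
pose B s := projT1 (cid (Jblock_rotation R (k s))).
have BP s := projT2 (cid (Jblock_rotation R (k s))).
(* A solution is transported along any equality of sizes: with [n'] a variable, the cast reduces to
   the identity. *)
have cast n n' (e : n = n') (f : 'cV[R]_2 -> 'cV[R]_2) (M : _ -> 'M[R]_n) C :
    \tr C = 0 -> (forall z, C^T *m M z + M z *m C = M (f z)) ->
    exists C' : 'M[R]_n', \tr C' = 0 /\ forall z,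
      C'^T *m castmx (e, e) (M z) + castmx (e, e) (M z) *m C'
      = castmx (e, e) (M (f z)).
  by case: _ / e => trC CP; exists C.
apply: (cast _ _ (dim_JS k) _ (fun z => mxdiag (fun s => Jblock (k s) z))
  (mxdiag B)) => [|z].
  by rewrite mxtrace_mxdiag big1 // => s _; case: (BP s).
rewrite tr_mxdiag !mxdiagM -mxdiagD; apply: eq_mxdiag => s.
by case: (BP s).
Qed.

End JS.

Theorem proposition5p4 (R : realType) (r : nat) (k : 'I_r -> nat)
    (hr : (0 < r)%N) (hk : forall s : 'I_r, (0 < k s)%N) :
  nonsingular (mu_S R k) /\
  lie_isomorphic (lie_quot (Der_gr (mu_S R k)) (Der_0 (mu_S R k))) (so R 2).
Proof.
have mu_unit : nonsingular (mu_S R k).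
  by move=> z z0; rewrite J_mu_S JS_unitmx.
split=> //; have [B [trB BP]] := JS_rotation R k.
apply: (@der_gr_so2 _ _ _ _ mu_unit B) => // [|z]; last by rewrite !J_mu_S.
(* The first block already makes the dimension of n_1 positive. *)
by rewrite muln_gt0 /= (bigD1 (Ordinal hr)) //= addn_gt0 hk.
Qed.
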